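(* Let $b,c$ be positive integers. Suppose $x\in\mathcal{A}(b,c)$ is pointed at $(a_1,a_2)\in\mathbb{Z}^2$, with $$x=x_1^{-a_1}x_2^{-a_2}\sum_{p,q\ge0}c(p,q)\,x_1^{bp}x_2^{cq},\qquad c(p,q)\in\mathbb{Z},\ c(0,0)=1,$$ and suppose $x$ is positive at the three consecutive clusters $\{x_0,x_1\}$, $\{x_1,x_2\}$, and $\{x_2,x_3\}$. Then for every nonzero pair of indices $(p,q)\in\mathbb{Z}_{\ge0}^2$, $$c(p,q)\ge\max\left(\sum_{k=1}^p(-1)^{k-1}c(p-k,q)\binom{a_2-cq+k-1}{k},\ \sum_{k=1}^q(-1)^{k-1}c(p,q-k)\binom{a_1-bp+k-1}{k}\right).$$
   Context: Let $\mathcal{F}=\mathbb{Q}(x_1,x_2)$ and define $x_m\in\mathcal{F}$ for all $m\in\mathbb{Z}$ by $x_{m-1}x_{m+1}=x_m^b+1$ for $m$ odd and $x_{m-1}x_{m+1}=x_m^c+1$ for $m$ even. $\mathcal{A}(b,c)$ is the subring of $\mathcal{F}$ generated by all $x_m$; clusters are the sets $\{x_m,x_{m+1}\}$. By the Laurent phenomenon every element of $\mathcal{A}(b,c)$ is a Laurent polynomial with integer coefficients in $x_m,x_{m+1}$, for each $m$. A non-zero element is positive at the cluster $\{x_m,x_{m+1}\}$ if all (nonzero) coefficients of its Laurent expansion in $x_m,x_{m+1}$ are positive. An element is pointed at $(a_1,a_2)$ if it has an expansion of the displayed form (with finitely many nonzero $c(p,q)$). Conventions: $\binom{a}{k}=0$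 unless $0\le k\le a$; an empty sum is $0$. *)

(* Defs.v *)
From HB Require Import structures.
From mathcomp Require Import all_boot all_order all_algebra.
From mathcomp Require Import finmap.
From mathcomp Require Import mpoly.

Set Implicit Arguments.
Unset Strict Implicit.
Unset Printing Implicit Defensive.

Import Order.TTheory GRing.Theory Num.Theory.

Local Open Scope ring_scope.

(* The ambient field Q(x_1, x_2). *)
Notation ratF := {fraction {mpoly rat[2]}}.

Definition X1 : ratF := tofrac ('X_ord0 : {mpoly rat[2]}).
Definition X2 : ratF := tofrac ('X_ord_max : {mpoly rat[2]}).

(* Exponent of x_m in the exchange relation for x_(m-1) x_(m+1). *)
Definition exch_exp (b c : nat) (m : int) : nat := if odd `|m|%N then b else c.

(* fwd b c n = (x_(1+n), x_(2+n)) and bwd b c n = (x_(1-n), x_(2-n)), obtained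
   by solving the exchange relations away from the initial cluster {x_1, x_2};
   see [cluster_var_exchange] below. *)
Fixpoint fwd (b c n : nat) : ratF * ratF :=
  if n is n'.+1 then
    let: (u, v) := fwd b c n' in
    (v, (v ^+ exch_exp b c (2 + n'%:Z) + 1) / u)
  else (X1, X2).

Fixpoint bwd (b c n : nat) : ratF * ratF :=
  if n is n'.+1 then
    let: (u, v) := bwd b c n' in
    ((u ^+ exch_exp b c (1 - n'%:Z) + 1) / v, u)
  else (X1, X2).

Definition cluster_var (b c : nat) (m : int) : ratF :=
  match m - 1 with
  | Posz n => (fwd b c n).1
  | Negz n => (bwd b c n.+1).1
  end.

Inductive generated_subring (R : nzRingType) (S : R -> Prop) : R -> Prop :=
| gen_in z : S z -> generated_subring S z
| gen_one : generated_subring S 1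
| gen_sub z w :
    generated_subring S z -> generated_subring S w -> generated_subring S (z - w)
| gen_mul z w :
    generated_subring S z -> generated_subring S w -> generated_subring S (z * w).

Definition cluster_algebra (b c : nat) : ratF -> Prop :=
  generated_subring (fun z => exists m : int, z = cluster_var b c m).

(* L, as a finitely supported family of integer coefficients indexed by Z^2, is
   a Laurent expansion of z in the cluster {x_m, x_(m+1)}. *)
Definition laurent_expansion (b c : nat) (m : int)
    (L : {fsfun int * int -> int with 0}) (z : ratF) : Prop :=
  z = \sum_(ij <- finsupp L)
        (L ij)%:~R * cluster_var b c m ^ ij.1 * cluster_var b c (m + 1) ^ ij.2.

Definition positive_at (b c : nat) (m : int) (z : ratF) : Prop :=
  z != 0 /\
  exists2 L : {fsfun int * int -> int with 0},
    laurent_expansion b c m L z & forall ij, ij \in finsupp L -> 0 < L ij.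

Definition pointed_expansion (b c : nat) (a1 a2 : int)
    (C : {fsfun nat * nat -> int with 0}) (z : ratF) : Prop :=
  C (0%N, 0%N) = 1 /\
  z = cluster_var b c 1 ^ (- a1) * cluster_var b c 2 ^ (- a2) *
      \sum_(pq <- finsupp C)
        (C pq)%:~R * cluster_var b c 1 ^+ (b * pq.1)
                   * cluster_var b c 2 ^+ (c * pq.2).

(* Binomial coefficient with integer upper index, with the convention that it
   vanishes unless 0 <= k <= a (in particular for every negative a). *)
Definition binz (a : int) (k : nat) : int :=
  if a is Posz n then 'C(n, k)%:Z else 0.

Lemma cluster_var1 (b c : nat) : cluster_var b c 1 = X1.
Proof. by []. Qed.

Lemma cluster_var2 (b c : nat) : cluster_var b c 2 = X2.
Proof. by []. Qed.

(* Quotients of polynomials positive at (1, 1); all cluster variables are such,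
   so no division by zero occurs in [fwd] and [bwd]. *)
Definition ratpos (z : ratF) : Prop :=
  exists p q : {mpoly rat[2]},
    [/\ 0 < p.@[fun=> 1], 0 < q.@[fun=> 1] & z = tofrac p / tofrac q].

Lemma evalpos_neq0 (p : {mpoly rat[2]}) :
  0 < p.@[fun=> 1] -> tofrac p != 0 :> ratF.
Proof.
move=> p_gt0; rewrite tofrac_eq0; apply/eqP => p0.
by move: p_gt0; rewrite p0 meval0 ltxx.
Qed.

Lemma ratpos_neq0 z : ratpos z -> z != 0.
Proof.
case=> p [q [p0 q0 ->]].
by rewrite mulf_neq0 ?invr_eq0 ?evalpos_neq0.
Qed.

Lemma ratpos1 : ratpos 1.
Proof. by exists 1, 1; split; rewrite ?meval1 // tofrac1 divr1. Qed.

Lemma ratposX i : ratpos (tofrac ('X_i : {mpoly rat[2]})).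
Proof. by exists 'X_i, 1; split; rewrite ?meval1 ?mevalXU // tofrac1 divr1. Qed.

Lemma ratposM z w : ratpos z -> ratpos w -> ratpos (z * w).
Proof.
case=> p [q [p0 q0 ->]] [r [s [r0 s0 ->]]].
exists (p * r), (q * s); split; rewrite ?mevalM ?mulr_gt0 //.
by rewrite !tofracM invfM mulrACA.
Qed.

Lemma ratposV z : ratpos z -> ratpos z^-1.
Proof.
by case=> p [q [p0 q0 ->]]; exists q, p; split=> //; rewrite invfM invrK mulrC.
Qed.

Lemma ratposD z w : ratpos z -> ratpos w -> ratpos (z + w).
Proof.
case=> p [q [p0 q0 ->]] [r [s [r0 s0 ->]]].
exists (p * s + r * q), (q * s).
split; rewrite ?mevalD ?mevalM ?addr_gt0 ?mulr_gt0 //.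
by rewrite tofracD !tofracM addf_div ?evalpos_neq0.
Qed.

Lemma ratpos_exch z w n : ratpos z -> ratpos w -> ratpos ((z ^+ n + 1) / w).
Proof.
move=> zpos wpos; apply: ratposM (ratposV wpos).
apply: ratposD ratpos1; elim: n => [|n IHn]; first exact: ratpos1.
by rewrite exprS; apply: ratposM.
Qed.

Lemma fwd_pos b c n : ratpos (fwd b c n).1 /\ ratpos (fwd b c n).2.
Proof.
elim: n => [|n] /=; first by split; apply: ratposX.
by case: (fwd b c n) => u v /= [upos vpos]; split=> //; apply: ratpos_exch.
Qed.

Lemma bwd_pos b c n : ratpos (bwd b c n).1 /\ ratpos (bwd b c n).2.
Proof.
elim: n => [|n] /=; first by split; apply: ratposX.
by case: (bwd b c n) => u v /= [upos vpos]; split=> //; apply: ratpos_exch.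
Qed.

Lemma cluster_var_neq0 (b c : nat) (m : int) : cluster_var b c m != 0.
Proof.
rewrite /cluster_var; case: (m - 1) => n; apply: ratpos_neq0.
  by case: (fwd_pos b c n).
by case: (bwd_pos b c n.+1).
Qed.

Lemma cluster_var_fwd b c n :
  fwd b c n = (cluster_var b c (1 + n%:Z), cluster_var b c (2 + n%:Z)).
Proof.
have E k : (fwd b c k).1 = cluster_var b c (1 + k%:Z).
  by rewrite /cluster_var [1 + _]addrC addrK.
rewrite [LHS]surjective_pairing E; congr pair.
rewrite (_ : 2 + n%:Z = 1 + n.+1%:Z); last by rewrite intS addrA.
by rewrite -E /=; case: (fwd b c n).
Qed.

Lemma cluster_var_bwd b c n :
  bwd b c n = (cluster_var b c (1 - n%:Z), cluster_var b c (2 - n%:Z)).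
Proof.
have E k : (bwd b c k).1 = cluster_var b c (1 - k%:Z).
  by rewrite /cluster_var addrAC subrr add0r; case: k.
rewrite [LHS]surjective_pairing E; congr pair.
case: n => [|n]; first by [].
rewrite (_ : 2 - n.+1%:Z = 1 - n%:Z); last by rewrite intS opprD addrA.
by rewrite -E /=; case: (bwd b c n).
Qed.

Lemma cluster_var_exchange (b c : nat) (m : int) :
  cluster_var b c (m - 1) * cluster_var b c (m + 1) =
  cluster_var b c m ^+ (if odd `|m|%N then b else c) + 1.
Proof.
case E : (m - 2) => [n|n].
  have -> : m = 2 + n%:Z by rewrite -E addrCA subrr addr0.
  have := congr1 snd (cluster_var_fwd b c n.+1).
  rewrite [fwd _ _ _]/= cluster_var_fwd [LHS]/= [RHS]/=.
  rewrite (_ : 2 + n.+1%:Z = 2 + n%:Z + 1); last by rewrite intS addrAC addrA.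
  rewrite (_ : 2 + n%:Z - 1 = 1 + n%:Z); last by rewrite addrAC.
  by move=> <-; rewrite mulrC divfK ?cluster_var_neq0.
have -> : m = 1 - n%:Z.
  by rewrite -[LHS](subrK 2) E NegzE intS opprD addrAC.
have := congr1 fst (cluster_var_bwd b c n.+1).
rewrite [bwd _ _ _]/= cluster_var_bwd [LHS]/= [RHS]/=.
rewrite (_ : 1 - n.+1%:Z = 1 - n%:Z - 1); last by rewrite intS opprD addrAC addrA.
rewrite (_ : 1 - n%:Z + 1 = 2 - n%:Z); last by rewrite addrAC.
by move=> <-; rewrite divfK ?cluster_var_neq0.
Qed.

(* Main.v *)
Require Import Defs.
From HB Require Import structures.
From mathcomp Require Import all_boot all_order all_algebra.
From mathcomp Require Import finmap.
From mathcomp Require Import mpoly.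
From mathcomp Require Import zify ring.

Import Order.TTheory GRing.Theory Num.Theory.

Local Open Scope ring_scope.

(** Grouping the pointed expansion by powers of [x_2] gives
    [x = x_1^(-a_1) * \sum_q x_2^(c q - a_2) * P_q(x_1^b)], where
    [P_q(t) = \sum_p c(p,q) t^p].  The exchange relation
    [x_0 x_2 = x_1^b + 1] turns this into an expression in [x_0] and [x_1] in
    which the power [x_0^(a_2 - c q)] is multiplied by
    [x_1^(-a_1) P_q(t) (1 + t)^(-n)] with [t = x_1^b] and [n = a_2 - c q].
    Distinct [q] give distinct powers of [x_0], so by uniqueness of Laurent
    expansions positivity at [{x_0, x_1}] makes
    every [P_q(t) (1 + t)^(-n)] a polynomial with nonnegative coefficients.
    For [n > 0] its coefficient at [t^p] is
    [\sum_(k <= p) (-1)^k 'C(n + k - 1, k) c(p - k, q)], and its nonnegativity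
    is the first bound, once the term [k = 0] is isolated.  For [n <= 0] all the
    binomial coefficients vanish and the bound reads [0 <= c(p, q)], which is
    positivity at [{x_1, x_2}].  The second bound is the first one with the two
    variables exchanged: [x_1 x_3 = x_2^c + 1] relates the clusters [{x_1, x_2}]
    and [{x_2, x_3}] in the same way.

    Hence the core, [binomial_recursion_bound], is about two algebraically
    independent elements [u], [v] of a field and is used for [(x_1, x_2)] and
    for [(x_2, x_1)].  Uniqueness of expansions enters through [laurent_coef],
    which compares coefficients of powers of [v] alone, the coefficients being
    integer polynomials in [u]: negative powers of [u] and of [1 + u^b] are
    cleared beforehand by multiplying with fixed powers of both.  The division
    by [(1 + t)^n] is [coef_quotient_binomial]. *)

(** * Algebraically independent pairs *)

Definition polyeval {A : comNzRingType} (u : A) (f : {poly int}) : A :=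
  (map_poly intr f).[u].

HB.instance Definition _ (A : comNzRingType) (u : A) :=
  GRing.RMorphism.copy (polyeval u) (horner_eval u \o map_poly intr).

(** Iterated polynomials, rather than polynomials in two variables, because the
    proof compares coefficients of powers of [v] that are polynomials in [u]. *)
Definition alg_indep {F : fieldType} (u v : F) : Prop :=
  forall P : {poly {poly int}}, (map_poly (polyeval u) P).[v] = 0 -> P = 0.

Lemma polyevalX (A : comNzRingType) (u : A) : polyeval u 'X = u.
Proof. by rewrite /polyeval map_polyX hornerX. Qed.

Lemma polyevalZ (A : comNzRingType) (u : A) (a : int) f :
  polyeval u (a *: f) = a%:~R * polyeval u f.
Proof. by rewrite /polyeval map_polyZ /= hornerZ. Qed.

Lemma rmorph_polyeval (A B : comNzRingType) (phi : {rmorphism A -> B}) u f :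
  phi (polyeval u f) = polyeval (phi u) f.
Proof.
rewrite /polyeval -horner_map -map_poly_comp; congr _.[_].
by apply: eq_map_poly => a /=; rewrite rmorph_int.
Qed.

Lemma alg_indep_neq0l (F : fieldType) (u v : F) : alg_indep u v -> u != 0.
Proof.
move=> indep; apply/eqP => u0; move: (indep 'X%:P).
rewrite map_polyC hornerC /= polyevalX => /(_ u0) /eqP.
by rewrite polyC_eq0 polyX_eq0.
Qed.

Lemma alg_indep_neq0r (F : fieldType) (u v : F) : alg_indep u v -> v != 0.
Proof.
move=> indep; apply/eqP => v0; move: (indep 'X).
by rewrite map_polyX hornerX => /(_ v0) /eqP; rewrite polyX_eq0.
Qed.

(** Sending ['X_i] to the inner and ['X_j] to the outer variable of
    [{poly {poly rat}}] recovers, up to the injection of [int] into [rat], the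
    polynomial [P] from its value at the two variables. *)
Lemma alg_indep_variables (i j : 'I_2) : i != j ->
  alg_indep (tofrac ('X_i : {mpoly rat[2]})) (tofrac ('X_j : {mpoly rat[2]})).
Proof.
move=> neq_ij P.
pose iota : {rmorphism {mpoly rat[2]} -> ratF} := @tofrac {mpoly rat[2]}.
pose h (k : 'I_2) : {poly {poly rat}} := if k == i then 'X%:P else 'X.
pose psi : {rmorphism {mpoly rat[2]} -> {poly {poly rat}}} :=
  mmap (polyC \o polyC) h.
have psiX k : psi 'X_k = h k by rewrite /= mmapX mmap1U.
rewrite (@eq_map_poly _ _ _ (iota \o polyeval ('X_i : {mpoly rat[2]})));
  last by move=> f /=; rewrite (rmorph_polyeval _ _ iota).
rewrite map_poly_comp (horner_map iota) => /eqP; rewrite tofrac_eq0 => /eqP.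
move=> /(congr1 psi); rewrite -(horner_map psi) -map_poly_comp psiX /h.
rewrite eq_sym (negPf neq_ij) rmorph0.
rewrite (@eq_map_poly _ _ _ (polyC \o map_poly intr)); last first.
  move=> f /=; rewrite (rmorph_polyeval _ _ psi) psiX /h eqxx.
  by rewrite -(rmorph_polyeval _ _ polyC) /polyeval -/(comp_poly _ _) /=;
     congr _%:P; rewrite -[RHS]comp_polyXr /comp_poly -map_poly_comp;
     congr _.[_]; apply: eq_map_poly => a /=; rewrite rmorph_int.
rewrite map_poly_comp -/(comp_poly _ _) comp_polyXr => P0.
apply: (@map_inj_poly _ _ (map_poly (intr : int -> rat))); last 1 first.
- by rewrite P0 rmorph0.
- by apply: map_inj_poly => //; exact: intr_inj.
- by rewrite rmorph0.
Qed.

Lemma shift_nonneg (I : eqType) (s : seq I) (k : I -> int) :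
  exists N : nat, {in s, forall i, 0 <= k i + N%:Z}.
Proof.
exists (\sum_(i <- s) `|k i|%N)%N => i si.
have : (`|k i| <= \sum_(i <- s) `|k i|)%N by rewrite (big_rem i) //= leq_addr.
lia.
Qed.

Lemma exprz_shift (F : fieldType) (z : F) (m : int) (N : nat) :
  z != 0 -> 0 <= m + N%:Z -> z ^+ absz (m + N%:Z) = z ^ m * z ^+ N.
Proof. by move=> z0 mN; rewrite !exprnP -expfzDr // gez0_abs. Qed.

(** Uniqueness of expansions in powers of [v], with coefficients that are
    polynomials in [u]: multiplying both sides by a large power of [v] turns
    them into values of polynomials at [(u, v)].  Exponents may repeat, hence
    the sums over all indices with a given exponent. *)
Lemma laurent_coef {F : fieldType} {u v : F} (I J : eqType) (r : seq I)
    (s : seq J) (f : I -> {poly int}) (g : J -> {poly int})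
    (k : I -> int) (l : J -> int) : alg_indep u v ->
  \sum_(i <- r) polyeval u (f i) * v ^ k i =
  \sum_(j <- s) polyeval u (g j) * v ^ l j ->
  forall m, \sum_(i <- r | k i == m) f i = \sum_(j <- s | l j == m) g j.
Proof.
move=> indep Efg m; have v0 := alg_indep_neq0r _ _ _ indep.
(* Including m among the exponents to be shifted makes the coefficient at m
   available on both sides even when no term has that exponent. *)
have [N] := shift_nonneg _ (m :: map k r ++ map l s) id => Npos.
have shiftE (T : eqType) (t : seq T) (h : T -> {poly int}) (n : T -> int) :
    {subset map n t <= map k r ++ map l s} ->
  let P := \sum_(i <- t) h i *: 'X^(absz (n i + N%:Z)) in
  (map_poly (polyeval u) P).[v] =
     (\sum_(i <- t) polyeval u (h i) * v ^ n i) * v ^+ N /\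
  P`_(absz (m + N%:Z)) = \sum_(i <- t | n i == m) h i.
  move=> sub_t.
  have nN i : i \in t -> 0 <= n i + N%:Z.
    by move=> ti; apply: Npos; rewrite inE sub_t ?orbT ?map_f.
  split.
    rewrite rmorph_sum horner_sum mulr_suml; apply: eq_big_seq => i ti.
    rewrite /= map_polyZ hornerZ /= map_polyXn hornerXn.
    by rewrite exprz_shift ?nN ?mulrA.
  rewrite coef_sum [RHS]big_mkcond; apply: eq_big_seq => i ti.
  rewrite coefZ coefXn; have := nN i ti.
  have := Npos m (mem_head _ _); case: (n i =P m) => [->|ne] mN niN.
    by rewrite eqxx mulr1.
  by case: eqP => [|_]; [lia | rewrite mulr0].
have [|evP coefP] := shiftE _ r f k; first by move=> ?; rewrite mem_cat => ->.
have [|evQ coefQ] := shiftE _ s g l.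
  by move=> ?; rewrite mem_cat => ->; rewrite orbT.
rewrite -coefP -coefQ; congr (polyseq _)`_ _.
apply/eqP; rewrite -subr_eq0; apply/eqP.
by apply: indep; rewrite rmorphB hornerD hornerN evP evQ Efg subrr.
Qed.

(** * The binomial series with negative exponent *)

(** For [n = 0] the truncated
    subtraction is harmless: the term [k = 0] is ['C(0, 0) = 1] and the others
    vanish. *)
Lemma truncated_binomial_inverse (A : comNzRingType) (y : A) (n K : nat) :
  exists R, (1 + y) ^+ n * \sum_(k < K) (-1) ^+ k * 'C(n + k - 1, k)%:R * y ^+ k
            = 1 + y ^+ K * R.
Proof.
elim: n => [|n [R IHn]].
  case: K => [|K]; first by exists (- 1); rewrite big_ord0 mulr0 mul1r subrr.
  exists 0; rewrite expr0 mul1r mulr0 addr0 big_ord_recl big1 ?addr0.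
    by rewrite bin0 !mulr1.
  by move=> k _; rewrite bin_small ?mulr0 ?mul0r //= /bump; lia.
(* Multiplying the truncated series for n + 1 by 1 + y gives the one for n by
   Pascal's rule, except for the boundary term (-1) ^+ K * w K * y ^+ K. *)
pose w (k : nat) := 'C(n + k, k)%:R - 'C(n + k - 1, k)%:R : A.
have pascal k : w k.+1 = 'C(n + k, k)%:R.
  rewrite /w addnS subn1 /= binS natrD; ring.
have step : (1 + y) * \sum_(k < K) (-1) ^+ k * 'C(n.+1 + k - 1, k)%:R * y ^+ k
          = \sum_(k < K) (-1) ^+ k * 'C(n + k - 1, k)%:R * y ^+ k
            - (-1) ^+ K * w K * y ^+ K.
  elim: K {R IHn} => [|K IHK].
    by rewrite !big_ord0 /w addn0 !bin0 subrr; ring.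
  rewrite !big_ord_recr /= mulrDr IHK pascal addSn subn1 /= /w !exprS; ring.
exists (R - (1 + y) ^+ n * ((-1) ^+ K * w K)).
rewrite exprSr -mulrA step mulrBr IHn; ring.
Qed.

(** The right-hand side is the coefficient extraction from
    [T * (1 + 'X) ^- n]; multiplying by a truncation of that power series
    keeps the division inside the polynomial ring. *)
Lemma coef_quotient_binomial (b e n : nat) (G T : {poly int}) (p : nat) :
  (0 < b)%N -> (1 + 'X^b) ^+ n * G = 'X^e * (T \Po 'X^b) ->
  G`_(e + b * p) =
    \sum_(k < p.+1) T`_(p - k) * ((-1) ^+ k * 'C(n + k - 1, k)%:R).
Proof.
move=> b_gt0 GE.
(* That 'X^e divides G is not known here, so the truncation order has to exceed
   the whole index e + b * p, not only p. *)
pose K := (e + b * p).+1.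
have [R RE] := truncated_binomial_inverse _ ('X^b : {poly int}) n K.
pose W : {poly int} := \poly_(k < K) ((-1) ^+ k * 'C(n + k - 1, k)%:R).
have WE : W \Po 'X^b = \sum_(k < K)
    (-1) ^+ k * 'C(n + k - 1, k)%:R * ('X^b) ^+ k.
  rewrite /W poly_def (raddf_sum (comp_poly _)); apply: eq_bigr => k _ /=.
  rewrite comp_polyZ rmorphXn /= comp_polyX -mul_polyC.
  by rewrite rmorphM rmorphXn rmorphN1 rmorph_nat.
have GW : G + 'X^(b * K) * (R * G) = 'X^e * ((T * W) \Po 'X^b).
  by rewrite comp_polyM [RHS]mulrA -GE WE [RHS]mulrAC RE exprM; ring.
have /(congr1 (fun f : {poly int} => f`_(e + b * p))) := GW.
have sK : (e + b * p < b * K)%N by rewrite -[X in (X <= _)%N]mul1n leq_mul.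
rewrite coefD (coefXnM (b * K)%N) sK addr0 => ->.
rewrite coefXnM ltnNge leq_addr /= addKn coef_comp_poly_Xn //.
rewrite dvdn_mulr // mulKn // coefMr; apply: eq_bigr => k _.
rewrite coef_poly ifT //.
by have := ltn_ord k; rewrite /K; nia.
Qed.

(** * Rows of a pointed expansion *)

Definition row_poly (C : nat * nat -> int) (s : seq (nat * nat)) (q : nat) :
    {poly int} :=
  \sum_(pq <- s | pq.2 == q) C pq *: 'X^(pq.1).

Lemma coef_row_poly (C : nat * nat -> int) (s : seq (nat * nat)) (p q : nat) :
  uniq s -> (forall pq, pq \notin s -> C pq = 0) ->
  (row_poly C s q)`_p = C (p, q).
Proof.
move=> s_uniq C0; rewrite coef_sum big_mkcond.
rewrite (eq_bigr (fun pq => if pq == (p, q) then C (p, q) else 0)); last first.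
  case=> p' q' _ /=; rewrite coefZ coefXn xpair_eqE andbC [p == _]eq_sym.
  case: (q' =P q) => [->|_] //=.
  by case: (p' =P p) => [->|_]; rewrite ?mulr1 ?mulr0.
rewrite -big_mkcond -big_filter.
have [sp|nsp] := boolP ((p, q) \in s).
  by rewrite filter_pred1_uniq // big_seq1.
by rewrite (C0 _ nsp) big1.
Qed.

(** Comparison of a family in powers of [v] with a pointed expansion, row by
    row.  The factor [u ^+ A] clears the negative powers of [u], and [h] is
    whatever else has to be multiplied in to make the coefficients [f i]
    polynomials in [u]. *)
Lemma pointed_row {F : fieldType} {u v : F} (b c : nat) (a1 a2 : int) (A : nat)
    (C : nat * nat -> int) (s : seq (nat * nat))
    (I : eqType) (r : seq I) (f : I -> {poly int}) (k : I -> int)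
    (h : {poly int}) :
  alg_indep u v -> (0 < c)%N -> 0 <= - a1 + A%:Z ->
  \sum_(i <- r) polyeval u (f i) * v ^ k i =
    u ^+ A * polyeval u h *
    (u ^ (- a1) * v ^ (- a2) *
     \sum_(pq <- s) (C pq)%:~R * u ^+ (b * pq.1) * v ^+ (c * pq.2)) ->
  forall q, \sum_(i <- r | k i == (c * q)%N%:Z - a2) f i =
    h * ('X^(absz (- a1 + A%:Z)) * (row_poly C s q \Po 'X^b)).
Proof.
move=> indep c_gt0 A_ge E q.
have u0 := alg_indep_neq0l _ _ _ indep.
have v0 := alg_indep_neq0r _ _ _ indep.
rewrite (laurent_coef _ _ r s f
  (fun pq => h * ('X^(absz (- a1 + A%:Z)) * (C pq *: ('X^b) ^+ pq.1)))
  k (fun pq => (c * pq.2)%N%:Z - a2) indep); last first.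
  rewrite E !mulr_sumr; apply: eq_bigr => pq _.
  rewrite !rmorphM /= polyevalZ !rmorphXn /= polyevalX exprz_shift //.
  rewrite expfzDr // -exprnP exprM; ring.
rewrite /row_poly -!mulr_sumr; congr (_ * (_ * _)).
rewrite (raddf_sum (comp_poly 'X^b)); apply: eq_big => [pq|pq _].
  by rewrite (inj_eq (addIr _)) eqz_nat eqn_pmul2l.
by rewrite /= comp_polyZ rmorphXn /= comp_polyX.
Qed.

(** Both sides are expansions in [u] and [v], so the [C (p, q)] are among the
    nonnegative coefficients of the left-hand side; repetitions in [r] only add
    nonnegative terms. *)
Lemma pointed_coef_ge0 {F : fieldType} {u v : F} (b c : nat) (a1 a2 : int)
    (C : nat * nat -> int) (s : seq (nat * nat))
    (r : seq (int * int)) (L : int * int -> int) :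
  alg_indep u v -> (0 < b)%N -> (0 < c)%N ->
  uniq s -> (forall pq, pq \notin s -> C pq = 0) ->
  {in r, forall ij, 0 <= L ij} ->
  \sum_(ij <- r) (L ij)%:~R * u ^ ij.1 * v ^ ij.2 =
    u ^ (- a1) * v ^ (- a2) *
    \sum_(pq <- s) (C pq)%:~R * u ^+ (b * pq.1) * v ^+ (c * pq.2) ->
  forall p q, 0 <= C (p, q).
Proof.
move=> indep b_gt0 c_gt0 s_uniq C0 L_ge0 E p q.
have u0 := alg_indep_neq0l _ _ _ indep.
have [A A_ge] := shift_nonneg _ (- a1 :: map fst r) id.
have row_eq := pointed_row b c a1 a2 A C s _ r
  (fun ij => L ij *: 'X^(absz (ij.1 + A%:Z))) snd 1 indep c_gt0.
have : 0 <= (\sum_(ij <- r | ij.2 == (c * q)%N%:Z - a2)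
               L ij *: 'X^(absz (ij.1 + A%:Z)))`_(absz (- a1 + A%:Z) + b * p).
  rewrite coef_sum big_seq_cond sumr_ge0 // => ij /andP[rij _].
  by rewrite coefZ coefXn mulr_ge0 ?L_ge0.
rewrite row_eq ?A_ge ?mem_head //; last first.
  rewrite rmorph1 mulr1 -E mulr_sumr; apply: eq_big_seq => ij rij.
  rewrite polyevalZ rmorphXn /= polyevalX exprz_shift //; first ring.
  by apply: A_ge; rewrite inE map_f ?orbT.
by rewrite mul1r coefXnM ltnNge leq_addr /= addKn coef_comp_poly_Xn //
  dvdn_mulr // mulKn // coef_row_poly.
Qed.

(** * Positivity at a neighbouring cluster *)

(** The element [(u ^+ b + 1) / v] is the cluster variable exchanged with [v].
    For [n = a2 - c q > 0], the row [q] of the pointed expansion is,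
    up to powers of [u], [(1 + 'X^b) ^+ n] times the slice of the left-hand side where that variable
    has exponent [n], and the bound is nonnegativity of one coefficient of this
    slice. *)
Lemma binomial_recursion_bound {F : fieldType} {u v : F} (b c : nat)
    (a1 a2 : int) (C : nat * nat -> int) (s : seq (nat * nat))
    (r : seq (int * int)) (L : int * int -> int) :
  alg_indep u v -> (0 < b)%N -> (0 < c)%N ->
  uniq s -> (forall pq, pq \notin s -> C pq = 0) ->
  (forall p q, 0 <= C (p, q)) ->
  {in r, forall ij, 0 <= L ij} ->
  \sum_(ij <- r) (L ij)%:~R * ((u ^+ b + 1) / v) ^ ij.1 * u ^ ij.2 =
    u ^ (- a1) * v ^ (- a2) *
    \sum_(pq <- s) (C pq)%:~R * u ^+ (b * pq.1) * v ^+ (c * pq.2) ->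
  forall p q,
  \sum_(1 <= k < p.+1) (-1) ^+ (k - 1) * C ((p - k)%N, q)
     * binz (a2 - (c * q)%N%:Z + k%:Z - 1) k <= C (p, q).
Proof.
move=> indep b_gt0 c_gt0 s_uniq C0 C_ge0 L_ge0 E p q.
have u0 := alg_indep_neq0l _ _ _ indep.
have y0 : 1 + 'X^b != 0 :> {poly int}.
  apply/eqP => /(congr1 (fun f : {poly int} => f`_b)) /eqP.
  by rewrite coefD coefXn eqxx coef1 coef0; case: (b) b_gt0.
case E_n : (a2 - (c * q)%N%:Z) => [[|n]|n].
- rewrite big_nat big1 // => k /andP[k_gt0 _].
  by rewrite (_ : 0 + k%:Z - 1 = k.-1%:Z) /= ?bin_small ?mulr0; lia.
- have evy0 : u ^+ b + 1 != 0.
    apply/eqP => ev0; case/eqP: y0; move: (indep (1 + 'X^b)%:P).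
    rewrite map_polyC hornerC /= rmorphD rmorph1 rmorphXn /= polyevalX addrC.
    by move=> /(_ ev0) /eqP; rewrite polyC_eq0 => /eqP.
  (* u ^+ A and (1 + u ^+ b) ^+ D clear all negative powers of u and of
     1 + u ^+ b; the second factor cancels again once a row is isolated. *)
  have [A A_ge] := shift_nonneg _ (- a1 :: map snd r) id.
  have [D D_ge] := shift_nonneg _ (map fst r) id.
  have := pointed_row b c a1 a2 A C s _ r
    (fun ij => L ij *: ((1 + 'X^b) ^+ absz (ij.1 + D%:Z) *
                        'X^(absz (ij.2 + A%:Z))))
    (fun ij => - ij.1) ((1 + 'X^b) ^+ D) indep c_gt0 (A_ge _ (mem_head _ _)).
  move=> /(_ _ q) row_eq.
  pose e := absz (- a1 + A%:Z).
  pose G := \sum_(ij <- r | - ij.1 == (c * q)%N%:Z - a2)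
               L ij *: 'X^(absz (ij.2 + A%:Z)) : {poly int}.
  have {row_eq} GE : (1 + 'X^b) ^+ n.+1 * G = 'X^e * (row_poly C s q \Po 'X^b).
    apply: (mulfI (expf_neq0 D y0)); rewrite -row_eq; last first.
      rewrite -E mulr_sumr; apply: eq_big_seq => ij rij.
      rewrite polyevalZ rmorphM !rmorphXn /= rmorphD rmorph1 rmorphXn /=.
      rewrite polyevalX ![1 + _]addrC !exprz_shift //; last first.
      - by apply: D_ge; rewrite map_f.
      - by apply: A_ge; rewrite inE map_f ?orbT.
      by rewrite expfzMl exprz_inv; ring.
    rewrite mulrA -exprD mulr_sumr; apply: eq_bigr => ij /eqP ij_n.
    by rewrite -scalerAr (_ : absz (ij.1 + D%:Z) = (D + n.+1)%N) //; lia.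
  have G_ge0 : 0 <= G`_(e + b * p).
    rewrite coef_sum big_seq_cond sumr_ge0 // => ij /andP[rij _].
    by rewrite coefZ coefXn mulr_ge0 ?L_ge0.
  have coefG := coef_quotient_binomial _ _ _ _ _ p b_gt0 GE.
  rewrite -subr_ge0 (_ : _ - _ = G`_(e + b * p)) // coefG.
  rewrite big_ord_recl subn0 !coef_row_poly // bin0 !mulr1.
  rewrite big_add1 big_mkord -sumrN; congr (_ + _).
  apply: eq_bigr => k _.
  rewrite lift0 coef_row_poly // subn1.
  rewrite (_ : n.+1%:Z + k.+1%:Z - 1 = (n.+1 + k.+1 - 1)%N%:Z).
    by rewrite exprS natz /binz; ring.
  by lia.
- rewrite big_nat big1 // => k /andP[k_gt0 _].
  case Em : (Negz n + k%:Z - 1) => [m|m]; rewrite [binz _ _]/= ?mulr0 //.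
  by rewrite bin_small ?mulr0 //; move: Em; rewrite NegzE; lia.
Qed.

Definition swap {T : Type} (ij : T * T) : T * T := (ij.2, ij.1).

Lemma swapK (T : Type) : involutive (@swap T).
Proof. by case. Qed.

Theorem proposition1p5 (b c : nat) (hb : (0 < b)%N) (hc : (0 < c)%N)
    (x : ratF) (hx : cluster_algebra b c x) (a1 a2 : int)
    (C : {fsfun nat * nat -> int with 0})
    (hpt : pointed_expansion b c a1 a2 C x)
    (hpos0 : positive_at b c 0 x)
    (hpos1 : positive_at b c 1 x)
    (hpos2 : positive_at b c 2 x)
    (p q : nat) (hpq : (p, q) <> (0%N, 0%N)) :
  Num.max
    (\sum_(1 <= k < p.+1)
       (-1) ^+ (k - 1) * C ((p - k)%N, q)
         * binz (a2 - (c * q)%N%:Z + k%:Z - 1) k)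
    (\sum_(1 <= k < q.+1)
       (-1) ^+ (k - 1) * C (p, (q - k)%N)
         * binz (a1 - (b * p)%N%:Z + k%:Z - 1) k)
  <= C (p, q).
Proof.
have [_ xE] := hpt.
have C0 pq : pq \notin finsupp C -> C pq = 0 by exact: fsfun_dflt.
have indep12 : alg_indep X1 X2 by exact: alg_indep_variables.
have indep21 : alg_indep X2 X1 by exact: alg_indep_variables.
have C_ge0 i j : 0 <= C (i, j).
  have [_ [L LE L_gt0]] := hpos1.
  apply: (pointed_coef_ge0 b c a1 a2 C _ _ L indep12 hb hc (fset_uniq _) C0).
    by move=> ij /L_gt0 /ltW.
  exact: etrans (esym LE) xE.
rewrite ge_max; apply/andP; split.
  have [_ [L LE L_gt0]] := hpos0.
  apply: (binomial_recursion_bound b c a1 a2 C _ _ L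
            indep12 hb hc (fset_uniq _) C0 C_ge0).
    by move=> ij /L_gt0 /ltW.
  exact: etrans (esym LE) xE.
have [_ [L LE L_gt0]] := hpos2.
(* Second bound: the roles of x_1 and x_2 are exchanged. *)
apply: (binomial_recursion_bound c b a2 a1 (C \o swap) (map swap (finsupp C))
    (map swap (finsupp L)) (L \o swap) indep21 hc hb).
- by rewrite (map_inj_uniq (inv_inj (swapK _))) fset_uniq.
- move=> pq; rewrite -(swapK _ pq) (mem_map (inv_inj (swapK _))) /= swapK.
  exact: C0.
- by move=> i j; exact: C_ge0.
- by move=> ij /mapP[kl /L_gt0 /ltW L_ge0 ->]; rewrite /= swapK.
rewrite !big_map.
transitivity x.
  by rewrite LE; apply: eq_bigr => ij _ /=; rewrite swapK mulrAC.
rewrite xE [X in X * _]mulrC; congr (_ * _).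
by apply: eq_bigr => pq _ /=; rewrite swapK mulrAC.
Qed.
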